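(* Let $g:[0,\infty)\to[0,\infty)$ be a smooth diffusivity function such that the flux function $\Phi(s)=g(s^2)\,s$, $s\in\mathbb{R}$, has a finite Lipschitz constant $L$. Let $\bm K\in\mathbb{R}^{N\times N}$ be a convolution matrix and let $\tau>0$. Consider a symmetric residual network chaining any number of diffusion blocks $$\bm u^{k+1}=\bm u^k-\tau\,\bm K^\top\bm\Phi\!\left(\bm K\bm u^k\right),$$ with convolutions represented by $\bm K$ and with activation function $\tau\bm\Phi$. If $$\tau\le\frac{2}{L\,\|\bm K\|_2^2},$$ then the symmetric residual network is well-posed and stable in the Euclidean norm; that is, the network output is a continuous function of the input data, and $\|\bm u^{k+1}\|_2\le\|\bm u^k\|_2$ for each block.
   Context: $\bm\Phi$ denotes the componentwise application of the scalar function $\Phi$ to a vector in $\mathbb{R}^N$. A diffusion block maps $\bm u^k$ to $\bm u^{k+1}=\bm u^k-\tau\bm K^\top\bm\Phi(\bm K\bm u^k)$; a symmetric residual network is a finite composition of diffusion blocks. Well-posedness means that the network output depends continuously on the input data. Euclidean stability means that the Euclidean norm of the signal is nonincreasing in each block. For vectors, $\|\cdot\|_2$ is the Euclidean norm; for matrices, $\|\cdot\|_2$ is the induced spectral norm. The step size bound is understood as no restriction when $L\|\bm K\|_2^2=0$. *)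

(* Defs.v *)
From HB Require Import structures.
From mathcomp Require Import all_boot all_order all_algebra.
From mathcomp Require Import all_classical all_reals all_analysis.
Set Implicit Arguments.
Unset Strict Implicit.
Unset Printing Implicit Defensive.
Import Order.TTheory GRing.Theory Num.Theory.
Import numFieldNormedType.Exports.
Local Open Scope classical_set_scope.
Local Open Scope ring_scope.

(* The library norm on matrices is the maximum norm, hence this definition. *)
Definition norm2 {R : realType} {N : nat} (u : 'cV[R]_N) : R :=
  Num.sqrt (\sum_(i < N) u i 0 ^+ 2).

Definition spectral_norm {R : realType} {M N : nat} (A : 'M[R]_(M, N)) : R :=
  sup [set norm2 (A *m x) | x in [set x : 'cV[R]_N | norm2 x <= 1]].

(* C^infinity on [0, +oo), one-sided at 0: [d n] is the n-th derivative, and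
   difference quotients only use points of [0, +oo), so that the values of [g]
   at negative arguments are irrelevant. *)
Definition smooth_on_nonneg {R : realType} (g : R -> R) : Prop :=
  exists d : nat -> R -> R,
    (forall x, 0 <= x -> d 0%N x = g x) /\
    (forall n x, 0 <= x ->
      (d n y - d n x) / (y - x) @[y --> within `[0, +oo[ x^'] --> d n.+1 x).

Definition flux {R : realType} (g : R -> R) (s : R) : R := g (s ^+ 2) * s.

(* A discrete convolution of a signal of length N reads values outside
   {0, ..., N-1}. With N = 3 and the signal abc, the extensions are
     PadZero      ..000|abc|000..      PadPeriodic  ..abc|abc|abc..
     PadReplicate ..aaa|abc|ccc..      PadSymmetric ..cba|abc|cba..
     PadMirror    ..bcb|abc|bab.. *)
Variant padding :=
  PadZero | PadPeriodic | PadReplicate | PadSymmetric | PadMirror.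

(* The position from which the extended signal takes its value at [z]; the value
   is 0 when this position is not in {0, ..., N-1}. *)
Definition pad_index (p : padding) (N : nat) (z : int) : int :=
  match p with
  | PadZero => z
  | PadPeriodic => (z %% N%:Z)%Z
  | PadReplicate => Num.max 0 (Num.min z (N%:Z - 1))
  | PadSymmetric =>
      let m := (z %% (2 * N%:Z))%Z in Num.min m (2 * N%:Z - 1 - m)
  | PadMirror =>
      (* the period 2N - 2 would degenerate to 0 for N = 1 *)
      let P := Num.max 1 (2 * N%:Z - 2) in
      let m := (z %% P)%Z in Num.min m (P - m)
  end.

Definition extend {R : realType} {N : nat} (p : padding) (u : 'cV[R]_N)
    (z : int) : R :=
  \sum_(j < N | (j : nat)%:Z == pad_index p N z) u j 0.

(* [w k] is the kernel weight at offset k - r. *)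
Definition convolution {R : realType} {N : nat} (p : padding) (r : nat)
    (w : 'I_(r.*2.+1) -> R) (u : 'cV[R]_N) : 'cV[R]_N :=
  \col_(i < N) \sum_(k < r.*2.+1)
    w k * extend p u ((i : nat)%:Z - ((k : nat)%:Z - r%:Z)).

Definition convolution_matrix {R : realType} {N : nat} (K : 'M[R]_N) : Prop :=
  exists (p : padding) (r : nat) (w : 'I_(r.*2.+1) -> R),
    forall u : 'cV[R]_N, K *m u = convolution p w u.

Definition diffusion_block {R : realType} {N : nat} (K : 'M[R]_N)
    (Phi : R -> R) (tau : R) (u : 'cV[R]_N) : 'cV[R]_N :=
  u - tau *: (K^T *m map_mx Phi (K *m u)).

Definition symmetric_resnet {R : realType} {N : nat} (K : 'M[R]_N)
    (Phi : R -> R) (tau : R) (n : nat) (u : 'cV[R]_N) : 'cV[R]_N :=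
  iter n (diffusion_block K Phi tau) u.

Definition well_posed {R : realType} {N : nat}
    (F : 'cV[R]_N -> 'cV[R]_N) : Prop := continuous F.

(* The signal after k blocks is the output of the network truncated to k blocks. *)
Definition euclidean_stable {R : realType} {N : nat} (K : 'M[R]_N)
    (Phi : R -> R) (tau : R) (n : nat) : Prop :=
  forall (u0 : 'cV[R]_N) (k : nat), (k < n)%N ->
    norm2 (symmetric_resnet K Phi tau k.+1 u0)
      <= norm2 (symmetric_resnet K Phi tau k u0).

(* Main.v *)
Require Import Defs.
From HB Require Import structures.
From mathcomp Require Import all_boot all_order all_algebra.
From mathcomp Require Import all_classical all_reals all_analysis.
From mathcomp Require Import ring lra.
Import Order.TTheory GRing.Theory Num.Theory.
Import numFieldNormedType.Exports.
Local Open Scope classical_set_scope.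
Local Open Scope ring_scope.

(** A diffusion block is an explicit gradient step on the energy whose gradient
is [K^T Phi (K u)]. This energy need not be convex, since [Phi] need not be
monotone, but its gradient is cocoercive with respect to the stationary point 0,
and this suffices to bound norms. Write [v = K u], [w = Phi v] componentwise,
and [s] for the spectral norm of [K]. Expanding the square and moving [K^T] to
the other side of the scalar product gives

  |u - tau K^T w|^2 = |u|^2 - 2 tau <v, w> + tau^2 |K^T w|^2.

The last term is controlled by the middle one. First, [K^T] has the bound [s]
as well, so [|K^T w| <= s |w|] ([norm2_trmx_mulmx_le]). Second,
[Phi t = g (t^2) t] never has the sign opposite to [t], vanishes at 0 and is
[L]-Lipschitz, whence [Phi t ^ 2 <= L t Phi t] ([flux_sqr_le]) and, by summation,
[|w|^2 <= L <v, w>]. Therefore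

  |u - tau K^T w|^2 <= |u|^2 - tau <v, w> (2 - tau L s^2) <= |u|^2,

where [<v, w> >= 0] because diffusivities are nonnegative. In the form
[tau L s^2 <= 2], the step size bound holds automatically when [L s^2 = 0].

Well-posedness follows from the continuity of [Phi], which is Lipschitz: a block
is built from [Phi] and linear maps, and iteration preserves continuity. *)

(** * Euclidean geometry of column vectors *)

Definition dot {R : realType} {N : nat} (u v : 'cV[R]_N) : R :=
  (u^T *m v) 0 0.

Lemma dotE (R : realType) (N : nat) (u v : 'cV[R]_N) :
  dot u v = \sum_(i < N) u i 0 * v i 0.
Proof. by rewrite /dot mxE; apply: eq_bigr => i _; rewrite mxE. Qed.

Lemma norm2_ge0 (R : realType) (N : nat) (u : 'cV[R]_N) : 0 <= norm2 u.
Proof. exact: sqrtr_ge0. Qed.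

Lemma norm2_sqr (R : realType) (N : nat) (u : 'cV[R]_N) :
  norm2 u ^+ 2 = \sum_(i < N) u i 0 ^+ 2.
Proof. by rewrite sqr_sqrtr// sumr_ge0// => i _; rewrite sqr_ge0. Qed.

Lemma norm2_dot (R : realType) (N : nat) (u : 'cV[R]_N) :
  norm2 u ^+ 2 = dot u u.
Proof. by rewrite norm2_sqr dotE; apply: eq_bigr => i _; rewrite expr2. Qed.

Lemma dot_mulmxr (R : realType) (M N : nat) (A : 'M[R]_(M, N))
    (x : 'cV[R]_N) (y : 'cV[R]_M) : dot x (A^T *m y) = dot (A *m x) y.
Proof. by rewrite /dot trmx_mul mulmxA. Qed.

Lemma norm2_subZ_sqr (R : realType) (N : nat) (a : R) (u v : 'cV[R]_N) :
  norm2 (u - a *: v) ^+ 2 =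
  norm2 u ^+ 2 - 2 * a * dot u v + a ^+ 2 * norm2 v ^+ 2.
Proof.
rewrite !norm2_sqr dotE !mulr_sumr -sumrB -big_split/=.
by apply: eq_bigr => i _; rewrite !mxE; ring.
Qed.

Lemma norm2Z (R : realType) (N : nat) (a : R) (u : 'cV[R]_N) :
  norm2 (a *: u) = `|a| * norm2 u.
Proof.
rewrite /norm2 -sqrtr_sqr -sqrtrM ?sqr_ge0// mulr_sumr.
by congr Num.sqrt; apply: eq_bigr => i _; rewrite mxE exprMn.
Qed.

Lemma norm2_eq0 (R : realType) (N : nat) (u : 'cV[R]_N) :
  norm2 u = 0 -> u = 0.
Proof.
move=> u0; apply/matrixP => i j; rewrite mxE ord1; apply/eqP.
rewrite -sqrf_eq0; apply/eqP.
have /psumr_eq0P -> // : \sum_(i < N) u i 0 ^+ 2 = 0.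
  by rewrite -norm2_sqr u0 expr0n.
by move=> k _; rewrite sqr_ge0.
Qed.

Lemma norm20 (R : realType) (N : nat) : norm2 (0 : 'cV[R]_N) = 0.
Proof. by rewrite -(scale0r (0 : 'cV[R]_N)) norm2Z normr0 mul0r. Qed.

Lemma normr_le_norm2 (R : realType) (N : nat) (u : 'cV[R]_N) (i : 'I_N) :
  `|u i 0| <= norm2 u.
Proof.
rewrite -(ler_pXn2r (ltn0Sn 1)) ?nnegrE ?norm2_ge0// norm2_sqr.
rewrite real_normK ?num_real// (bigD1 i)//= lerDl sumr_ge0// => k _.
exact: sqr_ge0.
Qed.

(** * The spectral norm as an operator bound *)

(** The supremum of an unbounded set would be the junk value 0, so that the
spectral norm means nothing before this is known. *)
Lemma spectral_norm_has_ubound (R : realType) (M N : nat) (A : 'M[R]_(M, N)) :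
  has_ubound [set norm2 (A *m x) | x in [set x : 'cV[R]_N | norm2 x <= 1]].
Proof.
exists (Num.sqrt (\sum_(i < M) (\sum_(j < N) `|A i j|) ^+ 2)).
move=> _ [x /= x1 <-]; apply: ler_wsqrtr; apply: ler_sum => i _.
rewrite -real_normK ?num_real// ler_pXn2r ?nnegrE ?sumr_ge0// mxE.
apply: (le_trans (ler_norm_sum _ _ _)); apply: ler_sum => j _.
by rewrite normrM ler_piMr// (le_trans (normr_le_norm2 _ _ _ _)).
Qed.

Lemma spectral_norm_ge0 (R : realType) (M N : nat) (A : 'M[R]_(M, N)) :
  0 <= spectral_norm A.
Proof.
apply: (ub_le_sup (spectral_norm_has_ubound _ _ _ A)).
by exists 0; rewrite /= ?mulmx0 norm20.
Qed.

Lemma norm2_mulmx_le (R : realType) (M N : nat) (A : 'M[R]_(M, N))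
    (x : 'cV[R]_N) : norm2 (A *m x) <= spectral_norm A * norm2 x.
Proof.
have [x0|x_neq0] := eqVneq (norm2 x) 0.
  by rewrite (norm2_eq0 _ _ _ x0) mulmx0 !norm20 mulr0.
have x_gt0 : 0 < norm2 x by rewrite lt_neqAle eq_sym x_neq0 norm2_ge0.
have : norm2 (A *m ((norm2 x)^-1 *: x)) <= spectral_norm A.
  apply: (ub_le_sup (spectral_norm_has_ubound _ _ _ A)); eexists => //=.
  by rewrite norm2Z ger0_norm ?invr_ge0 ?norm2_ge0// mulVf.
rewrite -scalemxAr norm2Z ger0_norm ?invr_ge0 ?norm2_ge0//.
by rewrite mulrC ler_pdivrMr.
Qed.

(** With [y = A^T w] and [s = spectral_norm A], the scalar product [<A y, w>]
is [|y|^2], so that [0 <= |A y - s^2 w|^2 <= s^2 (s^2 |w|^2 - |y|^2)]. This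
gives the bound for [s > 0] without the Cauchy-Schwarz inequality. For [s = 0],
[A y = 0] and hence [|y|^2 = 0]. *)
Lemma norm2_trmx_mulmx_le (R : realType) (M N : nat) (A : 'M[R]_(M, N))
    (w : 'cV[R]_M) : norm2 (A^T *m w) <= spectral_norm A * norm2 w.
Proof.
set s := spectral_norm A; set y := A^T *m w.
have s_ge0 : 0 <= s := spectral_norm_ge0 _ _ _ A.
have Ay_w : dot (A *m y) w = norm2 y ^+ 2 by rewrite norm2_dot -dot_mulmxr.
have Ay_le : norm2 (A *m y) <= s * norm2 y := norm2_mulmx_le _ _ _ A y.
have [s0|s_neq0] := eqVneq s 0.
  have Ay0 : A *m y = 0.
    apply: norm2_eq0; apply/eqP.
    by rewrite eq_le norm2_ge0 andbT (le_trans Ay_le)// s0 mul0r.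
  suff -> : norm2 y = 0 by rewrite mulr_ge0 ?norm2_ge0.
  by apply/eqP; rewrite -sqrf_eq0 -Ay_w Ay0 /dot trmx0 mul0mx mxE.
have s2_gt0 : 0 < s ^+ 2 by rewrite exprn_gt0// lt_neqAle eq_sym s_neq0.
rewrite -(ler_pXn2r (ltn0Sn 1)) ?nnegrE ?mulr_ge0 ?norm2_ge0// exprMn.
rewrite -(ler_pM2l s2_gt0).
have Ay2_le : norm2 (A *m y) ^+ 2 <= s ^+ 2 * norm2 y ^+ 2.
  by rewrite -exprMn ler_pXn2r ?nnegrE ?mulr_ge0 ?norm2_ge0.
have := sqr_ge0 (norm2 (A *m y - s ^+ 2 *: w)).
rewrite norm2_subZ_sqr Ay_w; lra.
Qed.

(** * Flux functions *)

Lemma lipschitz_setTP (R : realType) (f : R -> R) (L : R) :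
  L.-lipschitz f -> forall x y, `|f x - f y| <= L * `|x - y|.
Proof. by move=> fL x y; exact: (fL (x, y)). Qed.

Lemma lipschitz_const_ge0 (R : realType) (f : R -> R) (L : R) :
  L.-lipschitz f -> 0 <= L.
Proof.
move=> fL; have := lipschitz_setTP _ _ _ fL 1 0.
by rewrite subr0 normr1 mulr1; apply: le_trans; exact: normr_ge0.
Qed.

Lemma flux_mul_ge0 (R : realType) (g : R -> R)
    (g_ge0 : forall x, 0 <= x -> 0 <= g x) (t : R) : 0 <= t * flux g t.
Proof. by rewrite /flux mulrCA -expr2 mulr_ge0 ?g_ge0 ?sqr_ge0. Qed.

(** Since [t] and [Phi t] never have opposite signs, this is the Lipschitz bound
[|Phi t| <= L |t|] multiplied by [|Phi t|]. *)
Lemma flux_sqr_le (R : realType) (g : R -> R) (L : R)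
    (g_ge0 : forall x, 0 <= x -> 0 <= g x)
    (flux_lipschitz : L.-lipschitz (flux g)) (t : R) :
  flux g t ^+ 2 <= L * (t * flux g t).
Proof.
have := lipschitz_setTP _ _ _ flux_lipschitz t 0.
rewrite {2}/flux mulr0 !subr0 => Phi_le.
rewrite -real_normK ?num_real// -(ger0_norm (flux_mul_ge0 _ _ g_ge0 t)).
by rewrite (normrM t) (mulrA L) expr2 ler_wpM2r.
Qed.

Lemma lipschitz_continuous (R : realType) (f : R -> R) (L : R) :
  L.-lipschitz f -> continuous f.
Proof.
move=> fL x; have L_ge0 := lipschitz_const_ge0 _ _ _ fL.
have L1_gt0 : 0 < L + 1 by rewrite ltr_wpDl.
apply/cvgrPdist_le => e e_gt0; near=> y.
apply: (le_trans (lipschitz_setTP _ _ _ fL x y)).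
have xy_le : `|x - y| <= e / (L + 1).
  by near: y; move: (e / _) (divr_gt0 e_gt0 L1_gt0); exact/cvgrPdist_le/cvg_id.
rewrite ler_pdivlMr// in xy_le; apply: le_trans xy_le.
by rewrite mulrC ler_wpM2l// lerDl.
Unshelve. all: by end_near. Qed.

(** * Stability of a block *)

(** The flux enters only through its sign and the bound [Phi t ^ 2 <= L t Phi t].
The latter bounds [|K^T w|^2] by [s^2 L <v, w>], and the step size condition
keeps this second order gain below the first order loss [2 tau <v, w>]. *)
Lemma norm2_diffusion_block_le (R : realType) (N : nat) (K : 'M[R]_N)
    (Phi : R -> R) (L tau : R)
    (Phi_ge0 : forall t, 0 <= t * Phi t)
    (Phi_sqr_le : forall t, Phi t ^+ 2 <= L * (t * Phi t))
    (tau_ge0 : 0 <= tau)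
    (tau_le : tau * (L * spectral_norm K ^+ 2) <= 2) (u : 'cV[R]_N) :
  norm2 (diffusion_block K Phi tau u) <= norm2 u.
Proof.
rewrite -(ler_pXn2r (ltn0Sn 1)) ?nnegrE ?norm2_ge0// /diffusion_block.
set v := K *m u; set w := map_mx Phi v; set s := spectral_norm K in tau_le *.
have vw_ge0 : 0 <= dot v w.
  by rewrite dotE sumr_ge0// => i _; rewrite [w i 0]mxE.
have w_le : norm2 w ^+ 2 <= L * dot v w.
  rewrite norm2_sqr dotE mulr_sumr ler_sum// => i _.
  by rewrite [w i 0]mxE.
have Kw_le : norm2 (K^T *m w) ^+ 2 <= s ^+ 2 * norm2 w ^+ 2.
  rewrite -exprMn ler_pXn2r ?nnegrE ?mulr_ge0 ?norm2_ge0 ?spectral_norm_ge0//.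
  exact: norm2_trmx_mulmx_le.
have {}Kw_le : norm2 (K^T *m w) ^+ 2 <= s ^+ 2 * (L * dot v w).
  by rewrite (le_trans Kw_le)// ler_wpM2l ?sqr_ge0.
have quad_le := ler_wpM2l (sqr_ge0 tau) Kw_le.
have lin_le := ler_wpM2r (mulr_ge0 tau_ge0 vw_ge0) tau_le.
rewrite norm2_subZ_sqr dot_mulmxr -/v; lra.
Qed.

(** * Continuity of a block *)

Lemma continuous_mx (R : realType) (T : topologicalType) (M N : nat)
    (f : T -> 'M[R]_(M, N)) :
  (forall i j, continuous (fun x => f x i j)) -> continuous f.
Proof.
move=> f_cont x A [P P_nbhs sPA].
have : \forall y \near x, forall i j, P i j (f y i j).
  by apply: filter_forall => i; apply: filter_forall => j; apply: f_cont.
by apply: filterS => y Py; apply: sPA.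
Qed.

Lemma continuous_mulmx (R : realType) (M N : nat) (A : 'M[R]_(M, N)) :
  continuous (fun x : 'cV[R]_N => A *m x).
Proof.
apply: continuous_mx => i j.
under eq_fun do rewrite mxE.
apply: continuous_big => [|k _]; first exact: add_continuous.
move=> x; apply: (@cvgMl_tmp _ _ (nbhs x)).
exact: coord_continuous.
Qed.

Lemma continuous_map_mx (R : realType) (M N : nat) (f : R -> R) :
  continuous f -> continuous (map_mx f : 'M[R]_(M, N) -> 'M[R]_(M, N)).
Proof.
move=> f_cont; apply: continuous_mx => i j.
under eq_fun do rewrite mxE.
by move=> x; apply: continuous_comp; [exact: coord_continuous|exact: f_cont].
Qed.

Lemma continuous_diffusion_block (R : realType) (N : nat) (K : 'M[R]_N)
    (Phi : R -> R) (tau : R) :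
  continuous Phi -> continuous (diffusion_block K Phi tau).
Proof.
move=> Phi_cont; apply: continuous_mx => i j.
pose force (u : 'cV[R]_N) := K^T *m map_mx Phi (K *m u).
have force_cont : continuous force.
  move=> u; apply: continuous_comp; last exact: continuous_mulmx.
  apply: continuous_comp; first exact: continuous_mulmx.
  exact: continuous_map_mx.
have -> : (fun u => diffusion_block K Phi tau u i j) =
    (fun u => u i j - tau * force u i j).
  by apply/funext => u; rewrite /diffusion_block !mxE.
move=> u; apply: (@cvgB _ _ _ (nbhs u)); first exact: coord_continuous.
apply: (@cvgMl_tmp _ _ (nbhs u)).
apply: (@continuous_comp _ _ _ force (fun y : 'cV[R]_N => y i j)).
  exact: force_cont.
exact: coord_continuous.
Qed.

(** * Networks of diffusion blocks *)

Theorem theorem2 (R : realType) (g : R -> R) (L : R) (N : nat)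
    (K : 'M[R]_N) (tau : R)
    (g_ge0 : forall x, 0 <= x -> 0 <= g x)
    (g_smooth : smooth_on_nonneg g)
    (flux_lipschitz : L.-lipschitz (flux g))
    (K_conv : convolution_matrix K)
    (tau_gt0 : 0 < tau)
    (tau_le : L * spectral_norm K ^+ 2 != 0 ->
              tau <= 2 / (L * spectral_norm K ^+ 2))
    (n : nat) :
  well_posed (symmetric_resnet K (flux g) tau n) /\
  euclidean_stable K (flux g) tau n.
Proof.
split.
  have block_cont := continuous_diffusion_block _ _ K _ tau
    (lipschitz_continuous _ _ _ flux_lipschitz).
  elim: n => [|n IHn] u; first exact: cvg_id.
  by apply: (continuous_comp (IHn u)); exact: block_cont.
move=> u0 k _; apply: (norm2_diffusion_block_le _ _ _ _ L).
- exact: flux_mul_ge0.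
- exact: flux_sqr_le.
- exact: ltW.
have [->|Ls_neq0] := eqVneq (L * spectral_norm K ^+ 2) 0.
  by rewrite mulr0 ler0n.
have L_ge0 := lipschitz_const_ge0 _ _ _ flux_lipschitz.
have Ls_gt0 : 0 < L * spectral_norm K ^+ 2.
  by rewrite lt_neqAle eq_sym Ls_neq0 mulr_ge0 ?sqr_ge0.
by rewrite -ler_pdivlMr ?tau_le.
Qed.
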